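(* Let $h$ be a nonnegative definite form in $\mathcal H$ with associated operator $H$, let $P$ be an orthogonal projection with finite dimensional range $\mathcal X=\operatorname{ran}(P)\subset\mathcal Q(h)$, and let $h'$ be the block diagonal part of $h$ with respect to $\mathcal X$. Put $\sin\Theta_p:=\sin\Theta_p(H^{1/2}\mathcal X,\mathsf{inv}(H^{1/2})\mathcal X)$. If $\sin\Theta_p<1$, then for all $u\in\mathcal Q(h)$ $$(1-\sin\Theta_p)\,h'[u]\le h[u]\le(1+\sin\Theta_p)\,h'[u],$$ $$\Big(1-\frac{\sin\Theta_p}{1-\sin\Theta_p}\Big)h[u]\le h'[u]\le\Big(1+\frac{\sin\Theta_p}{1-\sin\Theta_p}\Big)h[u].$$
   Context: $\mathcal H$ is a Hilbert space. A nonnegative form $h$ is a closed symmetric form with domain $\mathcal Q(h)$ dense in $\mathcal H$ and $h[u]:=h(u,u)\ge0$. Its associated operator $H$ is the nonnegative selfadjoint operator with $\mathcal D(H^{1/2})=\mathcal Q(h)$ and $h(u,v)=(H^{1/2}u,H^{1/2}v)$. The form (operator) is called nonnegative definite if moreover $\lambda_e(H)>0$, where $\lambda_e(H)$ is the infimum of the essential spectrum of $H$ ($+\infty$ if it is empty). The block diagonal part of $h$ with respect to $\operatorname{ran}(P)$ is $h'(u,v)=h(Pu,Pv)+h((I-P)u,(I-P)v)$, $u,v\in\mathcal Q(h)$. The inverse image is $\mathsf{inv}(H^{1/2})\mathcal X=\{x\in\mathcal D(H^{1/2}):H^{1/2}x\in\mathcal X\}$. For finite dimensional subspaces with orthogonal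 projections $P_1,P_2$, the maximal principal angle is $\Theta_p=\arcsin\min\{\|P_1(I-P_2)\|,\|P_2(I-P_1)\|\}$. *)

(* Defs.v *)
From HB Require Import structures.
From mathcomp Require Import all_boot all_order all_algebra.
From mathcomp Require Import complex.
From mathcomp Require Import boolp classical_sets reals ereal.
From mathcomp Require Import topology normedtype trigo.

Set Implicit Arguments.
Unset Strict Implicit.
Unset Printing Implicit Defensive.

Import Order.TTheory GRing.Theory Num.Theory.
Import numFieldNormedType.Exports.

Local Open Scope classical_set_scope.
Local Open Scope complex_scope.
Local Open Scope ring_scope.

(* Hilbert spaces are real or complex; everything below is uniform in [k]. *)
Variant scalars := Reals | Complexes.

Definition scalar_field (R : realType) (k : scalars) : numFieldType :=
  match k with Reals => R | Complexes => R[i] end.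

Definition of_real (R : realType) (k : scalars) :
    {rmorphism R -> scalar_field R k} :=
  match k return {rmorphism R -> scalar_field R k} with
  | Reals => idfun
  | Complexes => real_complex R
  end.

Definition real_part (R : realType) (k : scalars) : scalar_field R k -> R :=
  match k return scalar_field R k -> R with
  | Reals => id
  | Complexes => @complex.Re R
  end.

Definition sconj (R : realType) (k : scalars) :
    {rmorphism scalar_field R k -> scalar_field R k} :=
  match k return {rmorphism scalar_field R k -> scalar_field R k} with
  | Reals => idfun
  | Complexes => @conjc R
  end.

Arguments of_real {R} k.
Arguments real_part {R k}.
Arguments sconj {R} k.

(* The inner product is linear in its first argument. *)
Record hilbertType (R : realType) (k : scalars) := Hilbert {
  hilbert_sort :> completeNormedModType (scalar_field R k);
  inner : {dot hilbert_sort for sconj k};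
  inner_norm : forall x : hilbert_sort, `|x| ^+ 2 = inner x x
}.

Arguments inner {R k V} : rename.

Notation "''[' x , y ]" := (inner x y)
  (format "''[' x ,  y ]") : ring_scope.

Section HilbertSpace.
Context {R : realType} {k : scalars} {V : hilbertType R k}.
Local Notation K := (scalar_field R k).

Definition subspace (A : set V) : Prop :=
  A 0 /\ forall (a : K) (x y : V), A x -> A y -> A (a *: x + y).

Definition span_of (n : nat) (b : 'I_n -> V) : set V :=
  [set \sum_(i < n) c i *: b i | c in [set: 'I_n -> K]].

Definition finite_dim (A : set V) : Prop :=
  exists (n : nat) (b : 'I_n -> V), A = span_of b.

Definition orthogonal_projection (P : V -> V) : Prop :=
  [/\ linear P, forall x, P (P x) = P x & forall x y, '[P x, y] = '[x, P y]].

(* The orthogonal projection onto [A]; meaningful for closed subspaces [A],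
   for which the defining point exists and is unique. *)
Definition proj (A : set V) (x : V) : V :=
  xget 0 [set y | A y /\ forall z, A z -> '[x - y, z] = 0].

(* Meaningful for bounded [T]. *)
Definition opnorm (T : V -> V) : R :=
  sup [set real_part `|T x| | x in [set x : V | `|x| <= 1]].

Definition max_principal_angle (A B : set V) : R :=
  asin (Num.min (opnorm (fun x => proj A (x - proj B x)))
                (opnorm (fun x => proj B (x - proj A x)))).

(* Unbounded operators and forms: a total function, whose values outside
   the domain are irrelevant, together with the domain. *)
Record operator := Operator { dom : set V; op_val :> V -> V }.

Record sform := SForm { form_dom : set V; form_val :> V -> V -> K }.

Definition linear_operator (T : operator) : Prop :=
  subspace (dom T) /\
  forall (a : K) (x y : V), dom T x -> dom T y -> T (a *: x + y) = a *: T x + T y.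

Definition op_graph (T : operator) : set (V * V) :=
  [set p | dom T p.1 /\ T p.1 = p.2].

Definition adjoint_graph (T : operator) : set (V * V) :=
  [set p | forall x, dom T x -> '[T x, p.1] = '[x, p.2]].

Definition selfadjoint (T : operator) : Prop :=
  [/\ linear_operator T, dense (dom T) & op_graph T = adjoint_graph T].

Definition nonneg_selfadjoint (T : operator) : Prop :=
  selfadjoint T /\ forall x, dom T x -> 0 <= '[T x, x].

(* [S] is the nonnegative selfadjoint square root of [H], i.e. S o S = H as
   unbounded operators, on the natural domain of the composition. *)
Definition is_sqrt (S H : operator) : Prop :=
  [/\ nonneg_selfadjoint S,
      dom H = [set x | dom S x /\ dom S (S x)] &
      forall x, dom H x -> H x = S (S x)].

Definition preim_op (T : operator) (A : set V) : set V :=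
  [set x | dom T x /\ A (T x)].

Definition op_kernel (T : operator) : set V := [set x | dom T x /\ T x = 0].

Definition op_range (T : operator) : set V := T @` dom T.

Definition fredholm (T : operator) : Prop :=
  [/\ finite_dim (op_kernel T), closed (op_range T) &
      exists W : set V, finite_dim W /\
        forall v, exists y w, [/\ op_range T y, W w & v = y + w]].

Definition shift_op (T : operator) (l : R) : operator :=
  Operator (dom T) (fun x => T x - of_real k l *: x).

(* Only used for selfadjoint operators, whose spectrum is real. *)
Definition essential_spectrum (T : operator) : set R :=
  [set l | ~ fredholm (shift_op T l)].

Definition lambda_e (T : operator) : \bar R :=
  ereal_inf [set l%:E | l in essential_spectrum T].

Definition symmetric_form (h : sform) : Prop :=
  [/\ subspace (form_dom h),
      forall (a : K) (x y z : V),
        form_dom h x -> form_dom h y -> form_dom h z ->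
        h (a *: x + y) z = a * h x z + h y z &
      forall x y, form_dom h x -> form_dom h y -> h x y = sconj k (h y x)].

Definition closed_form (h : sform) : Prop :=
  forall (u_ : nat -> V) (u : V),
    (forall n, form_dom h (u_ n)) ->
    u_ @ \oo --> u ->
    (forall e : R, 0 < e ->
       \forall m & n \near \oo, h (u_ m - u_ n) (u_ m - u_ n) < of_real k e) ->
    form_dom h u /\
    forall e : R, 0 < e ->
      \forall n \near \oo, h (u_ n - u) (u_ n - u) < of_real k e.

Definition nonneg_form (h : sform) : Prop :=
  [/\ symmetric_form h, dense (form_dom h),
      forall u, form_dom h u -> 0 <= h u u & closed_form h].

(* [H] is the operator associated with [h], and [S] is its square root. *)
Definition associated (h : sform) (H S : operator) : Prop :=
  [/\ nonneg_selfadjoint H, is_sqrt S H, dom S = form_dom h &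
      forall u v, form_dom h u -> form_dom h v -> h u v = '[S u, S v]].

Definition nonneg_definite (h : sform) (H : operator) : Prop :=
  nonneg_form h /\ (0 < lambda_e H)%E.

Definition block_diagonal (h : sform) (P : V -> V) : sform :=
  SForm (form_dom h)
    (fun u v => h (P u) (P v) + h (u - P u) (v - P v)).

End HilbertSpace.

Arguments operator {R k} V.
Arguments sform {R k} V.

(* Main.v *)
(** Write X = ran P, p = Pu, q = u - Pu, so that h[u] - h'[u] = 2 Re (Sp, Sq)
    with S = H^(1/2); everything follows from |Re (Sp, Sq)| <= s |Sp| |Sq|.
    Put A = S X and B = inv(S) X, with projections P_A, P_B.  Since q is
    orthogonal to X, Sq is orthogonal to B, and so
    (Sp, Sq) = (Sp, P_A (I - P_B) Sq), which settles the case
    s = |P_A (I - P_B)|.  In the remaining case s = |P_B (I - P_A)| < 1, no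
    nonzero vector of B is orthogonal to A.  As ker S lies in B and is
    orthogonal to A, S is injective; the range of H is closed because 0 is not
    in the essential spectrum, so S is onto.  Then P_A maps B onto A, and if
    Sp = P_A b with b in B, subtracting from Sp its projection onto the line
    through b shows that Sp is at distance at most s |Sp| from B. *)

Require Import Defs.
From mathcomp Require Import all_boot all_order all_algebra.
From mathcomp Require Import complex ring lra.
From mathcomp Require Import boolp classical_sets reals ereal.
From mathcomp Require Import topology normedtype trigo.

Import Order.TTheory GRing.Theory Num.Theory.
Import numFieldNormedType.Exports.
Local Open Scope classical_set_scope.
Local Open Scope ring_scope.

(** * Comparison of the scalar field with the reals *)

Section Scalars.
Context {R : realType} {k : scalars}.
Local Notation K := (scalar_field R k).
Implicit Types (a b : K) (t : R).

Lemma real_partD a b : real_part (a + b) = real_part a + real_part b.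
Proof. by case: k a b => //= -[? ?] [? ?]. Qed.

Lemma real_part_realM t a : real_part (of_real k t * a) = t * real_part a.
Proof. by case: k a => //= -[? ?] /=; rewrite mul0r subr0. Qed.

Lemma real_part_sconj a : real_part (sconj k a) = real_part a.
Proof. by case: k a => //= -[? ?]. Qed.

Lemma of_realK t : real_part (of_real k t) = t.
Proof. by case: k. Qed.

Lemma ler_of_real (s t : R) : (of_real k s <= of_real k t) = (s <= t).
Proof. by case: k => //=; rewrite lecR. Qed.

Lemma ltr_of_real (s t : R) : (of_real k s < of_real k t) = (s < t).
Proof. by case: k => //=; rewrite ltcR. Qed.

(** In [R[i]] the relation [0 <= a] forces the imaginary part to vanish; this is what moves order
    statements from [K] to [R]. *)
Lemma real_partK a : 0 <= a -> of_real k (real_part a) = a.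
Proof. by case: k a => //= -[x y]; rewrite lecE /= => /andP[/eqP-> _]. Qed.

End Scalars.

(** * The underlying real inner product and Cauchy-Schwarz *)

Section RealInnerProduct.
Context {R : realType} {k : scalars} {V : hilbertType R k}.
Local Notation K := (scalar_field R k).
Implicit Types (x y z : V) (t : R) (a : K).

Lemma innerDl x y z : '[x + y, z] = '[x, z] + '[y, z].
Proof. exact: linearDl. Qed.

Lemma innerZl a x y : '[a *: x, y] = a * '[x, y].
Proof. exact: linearZl_LR. Qed.

Lemma innerC x y : '[x, y] = sconj k '[y, x].
Proof.
have := @hermitian_subproof _ _ _ _ (inner : {dot V for sconj k}) x y.
by rewrite expr0 mul1r.
Qed.

Lemma innerBl x y z : '[x - y, z] = '[x, z] - '[y, z].
Proof. by rewrite innerDl -scaleN1r innerZl mulN1r. Qed.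

Lemma inner0l x : '[0, x] = 0.
Proof. by have := innerZl 0 0 x; rewrite scale0r mul0r. Qed.

Lemma inner0r x : '[x, 0] = 0.
Proof. by rewrite innerC inner0l rmorph0. Qed.

Definition rinner x y : R := real_part '[x, y].
Definition rnorm x : R := real_part `|x|.

Lemma rinnerC x y : rinner x y = rinner y x.
Proof. by rewrite /rinner innerC real_part_sconj. Qed.

Lemma rinnerDl x y z : rinner (x + y) z = rinner x z + rinner y z.
Proof. by rewrite /rinner innerDl real_partD. Qed.

Lemma rinnerZl t x y : rinner (of_real k t *: x) y = t * rinner x y.
Proof. by rewrite /rinner innerZl real_part_realM. Qed.

Lemma rinnerNl x y : rinner (- x) y = - rinner x y.
Proof. by rewrite -scaleN1r -(rmorphN1 (of_real k)) rinnerZl mulN1r. Qed.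

Lemma rinnerBl x y z : rinner (x - y) z = rinner x z - rinner y z.
Proof. by rewrite rinnerDl rinnerNl. Qed.

Lemma rinnerDr x y z : rinner x (y + z) = rinner x y + rinner x z.
Proof. by rewrite ![rinner x _]rinnerC rinnerDl. Qed.

Lemma rinnerBr x y z : rinner x (y - z) = rinner x y - rinner x z.
Proof. by rewrite ![rinner x _]rinnerC rinnerBl. Qed.

Lemma rinnerZr t x y : rinner x (of_real k t *: y) = t * rinner x y.
Proof. by rewrite ![rinner x _]rinnerC rinnerZl. Qed.

Lemma rnormN x : rnorm (- x) = rnorm x.
Proof. by rewrite /rnorm normrN. Qed.

Lemma norm_rnorm x : `|x| = of_real k (rnorm x).
Proof. by rewrite real_partK. Qed.

Lemma rnorm_ge0 x : 0 <= rnorm x.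
Proof. by rewrite -(@ler_of_real _ k) rmorph0 -norm_rnorm. Qed.

Lemma inner_rnorm x : '[x, x] = of_real k (rnorm x ^+ 2).
Proof. by rewrite rmorphXn /= -norm_rnorm inner_norm. Qed.

Lemma rinner_rnorm x : rinner x x = rnorm x ^+ 2.
Proof. by rewrite /rinner inner_rnorm of_realK. Qed.

Lemma rnorm0_eq0 x : rnorm x = 0 -> x = 0.
Proof. by move=> x0; apply/normr0_eq0; rewrite norm_rnorm x0 rmorph0. Qed.

Lemma rnorm_gt0 x : x != 0 -> 0 < rnorm x.
Proof.
move=> x0; rewrite lt_neqAle rnorm_ge0 andbT eq_sym.
by apply: contra x0 => /eqP/rnorm0_eq0->.
Qed.

Lemma rnormZ t x : rnorm (of_real k t *: x) = `|t| * rnorm x.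
Proof.
apply/eqP; rewrite -(@eqrXn2 _ 2) ?mulr_ge0 ?rnorm_ge0//.
rewrite -rinner_rnorm rinnerZl rinnerZr rinner_rnorm exprMn.
by rewrite real_normK ?num_real// mulrA -expr2.
Qed.

Lemma rinner_orth x y : '[x, y] = 0 -> rinner x y = 0.
Proof. by rewrite /rinner -(rmorph0 (of_real k)) => ->; rewrite of_realK. Qed.

Lemma rnorm0 : rnorm 0 = 0.
Proof. by rewrite /rnorm normr0 -(rmorph0 (of_real k)) of_realK. Qed.

Lemma rinner0l x : rinner 0 x = 0.
Proof. by rewrite -(subrr 0) rinnerBl subrr. Qed.

Lemma rnormB_sqr x y :
  rnorm (x - y) ^+ 2 = rnorm x ^+ 2 - 2 * rinner x y + rnorm y ^+ 2.
Proof.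
rewrite -!rinner_rnorm rinnerBl !rinnerBr (rinnerC y x); ring.
Qed.

Lemma parallelogram x y :
  rnorm (x + y) ^+ 2 + rnorm (x - y) ^+ 2 = 2 * (rnorm x ^+ 2 + rnorm y ^+ 2).
Proof.
rewrite -!rinner_rnorm rinnerBl !rinnerBr rinnerDl !rinnerDr; ring.
Qed.

(** For nonzero vectors, expand the square of the norm of |y| x - |x| y and divide by 2 |x| |y|. *)
Lemma rinner_le x y : rinner x y <= rnorm x * rnorm y.
Proof.
have [->|x0] := eqVneq x 0; first by rewrite rinner0l rnorm0 mul0r.
have [->|y0] := eqVneq y 0; first by rewrite rinnerC rinner0l rnorm0 mulr0.
rewrite -(ler_pM2l (mulr_gt0 (rnorm_gt0 _ x0) (rnorm_gt0 _ y0))).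
have := sqr_ge0 (rnorm (of_real k (rnorm y) *: x - of_real k (rnorm x) *: y)).
rewrite rnormB_sqr rinnerZl rinnerZr !rnormZ !ger0_norm ?rnorm_ge0//; nra.
Qed.

Lemma rinner_sqr_le x y : rinner x y ^+ 2 <= rnorm x ^+ 2 * rnorm y ^+ 2.
Proof.
rewrite -exprMn -[leLHS]real_normK ?num_real//.
rewrite ler_sqr ?nnegrE ?mulr_ge0 ?rnorm_ge0// ler_norml rinner_le andbT.
by rewrite lerNl -rinnerNl -(rnormN x) rinner_le.
Qed.

Lemma rnorm_le1 x : (`|x| <= 1) = (rnorm x <= 1).
Proof. by rewrite norm_rnorm -(rmorph1 (of_real k)) ler_of_real. Qed.

End RealInnerProduct.

(** * Orthogonal projections and the sine of the maximal principal angle *)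

Section Projection.
Context {R : realType} {k : scalars} {V : hilbertType R k}.
Local Notation K := (scalar_field R k).
Implicit Types (x y z : V) (A B : set V).

Lemma subspaceZ A (a : K) x : Defs.subspace A -> A x -> A (a *: x).
Proof. by move=> [A0 Alin] Ax; rewrite -[_ *: _]addr0; apply: Alin. Qed.

Lemma subspaceD A x y : Defs.subspace A -> A x -> A y -> A (x + y).
Proof. by move=> [_ Alin] Ax Ay; rewrite -[x]scale1r; apply: Alin. Qed.

Lemma subspaceB A x y : Defs.subspace A -> A x -> A y -> A (x - y).
Proof.
by move=> sA Ax Ay; apply: subspaceD => //; rewrite -scaleN1r; apply: subspaceZ.
Qed.

(** The relation behind [proj]. Existence is tracked separately, because [proj A x] defaults to 0
    when no such point exists. *)
Definition is_proj A x y := A y /\ forall z, A z -> '[x - y, z] = 0.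

Lemma is_proj_uniq A x y y' :
  Defs.subspace A -> is_proj A x y -> is_proj A x y' -> y = y'.
Proof.
move=> sA [Ay yP] [Ay' y'P]; apply/eqP; rewrite -subr_eq0; apply/eqP/normr0_eq0.
apply/eqP; rewrite -sqrf_eq0 inner_norm.
have yy' : y - y' = (x - y') - (x - y).
  by rewrite opprB [RHS]addrC addrA subrK.
by rewrite {1}yy' innerBl yP ?y'P ?subrr//; apply: subspaceB.
Qed.

Lemma projE A x y : Defs.subspace A -> is_proj A x y -> proj A x = y.
Proof.
move=> sA yP.
have [|p0 pP] := @xgetPex _ 0 [set y | is_proj A x y]; first by exists y.
exact: is_proj_uniq sA (conj p0 pP) yP.
Qed.

Lemma projP A x : (exists y, is_proj A x y) -> is_proj A x (proj A x).
Proof. by move/(@xgetPex _ 0 [set y | is_proj A x y]). Qed.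

Lemma is_proj_sqr A x y : is_proj A x y ->
  rnorm x ^+ 2 = rnorm y ^+ 2 + rnorm (x - y) ^+ 2.
Proof.
move=> [Ay /(_ _ Ay)/rinner_orth]; rewrite rinnerBl rinner_rnorm => xy.
by rewrite rnormB_sqr; lra.
Qed.

Lemma is_projZ A (a : K) x y :
  Defs.subspace A -> is_proj A x y -> is_proj A (a *: x) (a *: y).
Proof.
move=> sA [Ay yP]; split=> [|z Az]; first exact: subspaceZ.
by rewrite -scalerBr innerZl yP// mulr0.
Qed.

(** Covers the default value of [proj], so that the norm bounds below hold for arbitrary sets. *)
Lemma proj_or A x : is_proj A x (proj A x) \/ proj A x = 0.
Proof.
have [/projP|] := pselect (exists y, is_proj A x y); first by left.
move=> nP; right; rewrite /proj xgetPN// => y yP; apply: nP; by exists y.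
Qed.

Lemma rnorm_proj_le A x : rnorm (proj A x) <= rnorm x.
Proof.
have [/is_proj_sqr xE|->] := proj_or A x; last by rewrite rnorm0 rnorm_ge0.
by rewrite -ler_sqr ?nnegrE ?rnorm_ge0// xE lerDl sqr_ge0.
Qed.

Lemma rnorm_proj_compl_le A x : rnorm (x - proj A x) <= rnorm x.
Proof.
have [/is_proj_sqr xE|->] := proj_or A x; last by rewrite subr0.
by rewrite -ler_sqr ?nnegrE ?rnorm_ge0// xE lerDr sqr_ge0.
Qed.

(** The one-sided quantity |P_A (I - P_B)|; the sine is the minimum over both orders of [A] and
    [B]. *)
Definition gap A B := opnorm (fun x => proj A (x - proj B x)).

Lemma gap_ub A B : ubound
  [set real_part `|proj A (x - proj B x)| | x in [set x : V | `|x| <= 1]] 1.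
Proof.
move=> _ [x /= x1 <-]; move: x1; rewrite rnorm_le1; apply: le_trans.
exact: le_trans (rnorm_proj_le _ _) (rnorm_proj_compl_le _ _).
Qed.

Lemma gap_ge A B x : rnorm x <= 1 -> rnorm (proj A (x - proj B x)) <= gap A B.
Proof.
move=> x1; apply: ub_le_sup; first by exists 1; apply: gap_ub.
by exists x => //=; rewrite rnorm_le1.
Qed.

Lemma gap_ge0 A B : 0 <= gap A B.
Proof. by apply: le_trans (gap_ge A B 0 _); rewrite ?rnorm_ge0 ?rnorm0. Qed.

Lemma gap_le1 A B : gap A B <= 1.
Proof.
apply: ge_sup; last exact: gap_ub.
by eexists; exists 0 => //=; rewrite normr0.
Qed.

Lemma sin_max_principal_angle A B :
  sin (max_principal_angle A B) = Num.min (gap A B) (gap B A).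
Proof.
apply: asinK; rewrite in_itv /= le_min ge_min gap_le1 /=.
by rewrite !(le_trans _ (gap_ge0 _ _)) ?lerN10.
Qed.

(** As w is orthogonal to B, P_A w = P_A (I - P_B) w, and Re (a, w) = Re (a, P_A w) because a lies
    in A. *)
Lemma rinner_le_gap A B a w : Defs.subspace A -> Defs.subspace B ->
  A a -> (exists y, is_proj A w y) -> (forall z, B z -> '[w, z] = 0) ->
  rinner a w <= gap A B * rnorm a * rnorm w.
Proof.
move=> sA sB Aa [y yP] wB.
have [w0|w0] := eqVneq (rnorm w) 0.
  by rewrite (rnorm0_eq0 _ w0) rinnerC rinner0l rnorm0 mulr0.
(* The supremum in [opnorm] runs over the unit ball, hence the normalisation. *)
pose c := of_real k (rnorm w)^-1.
have w_gt0 : 0 < rnorm w by rewrite lt_neqAle rnorm_ge0 eq_sym w0.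
have pB : proj B (c *: w) = 0.
  apply: projE => //; split=> [|z Bz]; first by case: sB.
  by rewrite subr0 innerZl wB// mulr0.
have pA : proj A (c *: w) = c *: y by apply: projE => //; apply: is_projZ.
have := gap_ge A B (c *: w); rewrite pB subr0 pA !rnormZ.
rewrite ger0_norm ?invr_ge0 ?rnorm_ge0// mulVf// => /(_ (lexx _)).
rewrite mulrC ler_pdivrMr// => y_le.
have aw : rinner a w = rinner a y.
  apply/eqP; rewrite -subr_eq0 -rinnerBr rinnerC rinner_orth//.
  by case: yP => _; apply.
rewrite aw (le_trans (rinner_le _ _))// mulrAC mulrC.
by rewrite ler_wpM2r ?rnorm_ge0.
Qed.

End Projection.

(** * Existence of projections onto finite dimensional and closed subspaces *)

Section Existence.
Context {R : realType} {k : scalars} {V : hilbertType R k}.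
Local Notation K := (scalar_field R k).
Implicit Types (x y z : V) (A B M : set V).

(** A Gram-Schmidt step: d = e - P_A e is orthogonal to A, so the projections onto A and onto the
    line of d add up. *)
Lemma is_proj_adjoin A A' e :
  Defs.subspace A -> (forall x, exists y, is_proj A x y) ->
  (forall v, A' v <-> exists c y, A y /\ v = c *: e + y) ->
  forall x, exists y, is_proj A' x y.
Proof.
move=> sA projA A'E x; have [p [Ap eA]] := projA e; have [y [Ay xA]] := projA x.
have {}eA v : A v -> '[v, e - p] = 0 by move=> Av; rewrite innerC eA// rmorph0.
set d := e - p in eA.
pose c := '[x, d] / '[d, d].
have xd : '[x - (y + c *: d), d] = 0.
  rewrite opprD addrA innerBl innerBl innerZl (eA y Ay) subr0.
  have [->|d0] := eqVneq d 0; first by rewrite !inner0r mulr0 subrr.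
  by rewrite mulfVK ?subrr// -inner_norm sqrf_eq0 normr_eq0.
exists (y + c *: d); split=> [|z /A'E[a [v [Av ->]]]].
  apply/A'E; exists c, (y - c *: p); split.
    by apply: subspaceB => //; apply: subspaceZ.
  by rewrite scalerBr addrCA addrA.
have -> : a *: e + v = a *: d + (a *: p + v).
  by rewrite scalerBr addrA subrK.
have w : A (a *: p + v) by case: sA => _; apply.
rewrite innerC innerDl innerZl [in X in a * X]innerC xd rmorph0 mulr0 add0r.
rewrite innerC opprD addrA innerBl xA// innerZl (innerC d) eA// rmorph0 mulr0.
by rewrite subrr !rmorph0.
Qed.

Lemma subspace_span n (b : 'I_n -> V) : Defs.subspace (span_of b).
Proof.
split=> [|a _ _ [c _ <-] [d _ <-]].
  by exists (fun=> 0) => //; apply: big1 => i _; rewrite scale0r.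
exists (fun i => a * c i + d i) => //; rewrite scaler_sumr -big_split /=.
by apply: eq_bigr => i _; rewrite scalerDl scalerA.
Qed.

Lemma finite_dim_is_proj A : finite_dim A -> forall x, exists y, is_proj A x y.
Proof.
move=> [n [b ->]]; elim: n b => [|n IH] b.
  move=> x; exists 0; split=> [|_ [c _ <-]]; first by case: (subspace_span _ b).
  by rewrite big_ord0 inner0r.
apply: (@is_proj_adjoin (span_of (fun i => b (lift ord0 i))) _ (b ord0)).
- exact: subspace_span.
- exact: IH.
move=> v; split=> [[c _ <-]|[c [_ [[d _ <-] ->]]]].
  exists (c ord0), (\sum_i c (lift ord0 i) *: b (lift ord0 i)).
  by rewrite big_ord_recl; split=> //; exists (c \o lift ord0).
exists (fun i => oapp d c (unlift ord0 i)) => //.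
rewrite big_ord_recl unlift_none; congr (_ + _).
by apply: eq_bigr => i _; rewrite liftK.
Qed.

Lemma subspace_finite_dim A : finite_dim A -> Defs.subspace A.
Proof. by move=> [n [b ->]]; apply: subspace_span. Qed.

(** The projection theorem: a minimising sequence is Cauchy by the parallelogram law, and its
    approximate orthogonality passes to the limit. *)
Lemma closed_is_proj M x :
  Defs.subspace M -> closed M -> exists y, is_proj M x y.
Proof.
move=> sM cM; pose D := [set rnorm (x - m) ^+ 2 | m in M].
have D_lb : has_lbound D by exists 0 => _ [m _ <-]; apply: sqr_ge0.
have D_inf : has_inf D.
  by split=> //; exists (rnorm (x - 0) ^+ 2), 0 => //; case: sM.
pose d := inf D.
have dle m : M m -> d <= rnorm (x - m) ^+ 2.
  by move=> Mm; apply: ge_inf => //; exists m.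
have /choice[u uP] n : exists m, M m /\ rnorm (x - m) ^+ 2 < d + n.+1%:R^-1.
  have [|_ [m Mm <-] mlt] := @inf_adherent _ _ n.+1%:R^-1 _ D_inf.
    by rewrite invr_gt0.
  by exists m.
have uM n : M (u n) by case: (uP n).
(* The infimum [d] bounds |x - u n - t z|^2 below for every real t; take the t
   minimising this quadratic. *)
have orth n z : M z -> rinner (x - u n) z ^+ 2 <= rnorm z ^+ 2 * n.+1%:R^-1.
  move=> Mz; have [_] := uP n; set w := x - u n; set r := rinner w z => wlt.
  have [z0|z0] := eqVneq z 0.
    by rewrite /r z0 rinnerC rinner0l rnorm0 expr0n mul0r.
  have zpos := rnorm_gt0 _ z0.
  have := dle (u n + of_real k (r / rnorm z ^+ 2) *: z).
  rewrite opprD addrA -/w rnormB_sqr rinnerZr rnormZ exprMn.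
  rewrite real_normK ?num_real//.
  have -> : rnorm w ^+ 2 - 2 * (r / rnorm z ^+ 2 * r) +
      (r / rnorm z ^+ 2) ^+ 2 * rnorm z ^+ 2 =
      rnorm w ^+ 2 - r ^+ 2 / rnorm z ^+ 2.
    by field; rewrite gt_eqF.
  move=> dw; rewrite mulrC -ler_pdivrMr ?exprn_gt0//.
  rewrite -(lerD2l d) (le_trans _ (ltW wlt))// -lerBrDr; apply: dw.
  exact: subspaceD (uM n) (subspaceZ _ _ _ sM Mz).
(* The midpoint lies in [M], so its squared distance to [x] is at least [d]; the parallelogram law
   leaves 2/(m+1) + 2/(n+1). *)
have u_near m n : (m <= n)%N -> rnorm (u m - u n) ^+ 2 <= 4 * m.+1%:R^-1.
  move=> mn; have [_ um] := uP m; have [_ un] := uP n.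
  have mid : M (of_real k 2^-1 *: (u m + u n)).
    by apply: subspaceZ => //; apply: subspaceD.
  have := dle _ mid.
  have -> : x - of_real k 2^-1 *: (u m + u n) =
      of_real k 2^-1 *: ((x - u n) + (x - u m)).
    apply: (@scalerI _ _ (of_real k 2)); first by rewrite fmorph_eq0 pnatr_eq0.
    rewrite scalerBr !scalerA -!rmorphM /= mulfV ?pnatr_eq0// rmorph1 !scale1r.
    by rewrite rmorph_nat scaler_nat mulr2n addrACA -opprD [u n + _]addrC.
  have -> : u m - u n = (x - u n) - (x - u m).
    by rewrite opprB [RHS]addrC addrA subrK.
  have nm : n.+1%:R^-1 <= m.+1%:R^-1 :> R by rewrite lef_pV2 ?posrE// ler_nat.
  have := parallelogram (x - u n) (x - u m).
  rewrite rnormZ exprMn ger0_norm ?invr_ge0//.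
  move: um un nm; move: n.+1%:R^-1 m.+1%:R^-1 => ? ?; lra.
have u_cauchy : cauchy (u @ \oo).
  apply: cauchy_exP => e e0.
  have e'0 : 0 < real_part e.
    by rewrite -(@ltr_of_real _ k) real_partK ?ltW// rmorph0.
  have e4 : 0 < real_part e ^+ 2 / 4 by rewrite divr_gt0 ?exprn_gt0.
  have [N _ NP] := near_infty_natSinv_lt (PosNum e4).
  exists (u N); exists N => // n /= Nn; rewrite -ball_normE /=.
  rewrite norm_rnorm -[ltRHS]real_partK ?ltW// ltr_of_real.
  rewrite -ltr_sqr ?nnegrE ?rnorm_ge0 ?ltW//.
  apply: le_lt_trans (u_near _ _ Nn) _; rewrite mulrC -ltr_pdivlMr//.
  exact: NP (leqnn N).
have uy : u @ \oo --> lim (u @ \oo) by exact: cauchy_cvg.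
set y := lim _ in uy.
exists y; split; first by apply: (closed_cvg M cM _ y uy); apply: nearW.
suff ryz z : M z -> rinner (x - y) z = 0.
  move=> z Mz; have := ryz _ (subspaceZ _ '[x - y, z] _ sM Mz).
  rewrite rinnerC /rinner innerZl (innerC z).
  (* testing against '[x - y, z] *: z recovers |'[x - y, z]|^2 *)
  move: ('[_, _]); case: (k) => /= [a /eqP|[a b]] /=.
    by rewrite mulf_eq0 orbb => /eqP.
  move=> ab; have : a ^+ 2 + b ^+ 2 = 0 by rewrite -ab; ring.
  by move/eqP; rewrite paddr_eq0 ?sqr_ge0// !sqrf_eq0 => /andP[/eqP-> /eqP->].
move=> Mz; apply/eqP; rewrite -sqrf_eq0 eq_le sqr_ge0 andbT.
rewrite leNgt; apply/negP => r0.
set r := rinner _ _ in r0.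
(* Chosen so that r^2 = 4 |z|^2 e + 4 e. Once 1/(n+1) and |y - u n|^2 are below e, the estimates
   give r^2 <= 4 |z|^2 e, a contradiction; the + 1 covers z = 0. *)
pose e := r ^+ 2 / (4 * (rnorm z ^+ 2 + 1)).
have z1 : 0 < rnorm z ^+ 2 + 1 by rewrite ltr_wpDl ?sqr_ge0.
have e0 : 0 < e by rewrite divr_gt0// mulr_gt0.
have se0 : 0 < of_real k (Num.sqrt e).
  by rewrite -(rmorph0 (of_real k)) ltr_of_real sqrtr_gt0.
have /cvgrPdist_lt/(_ _ se0) uye := uy.
near \oo => n.
have ne : n.+1%:R^-1 < e by near: n; apply: (near_infty_natSinv_lt (PosNum e0)).
have : `|y - u n| < of_real k (Num.sqrt e) by near: n.
rewrite norm_rnorm ltr_of_real -ltr_sqr ?nnegrE ?rnorm_ge0 ?sqrtr_ge0//.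
rewrite sqr_sqrtr ?ltW// => yu.
have cs := rinner_sqr_le (y - u n) z.
have := orth n _ Mz.
have -> : x - u n = (x - y) + (y - u n) by rewrite addrA subrK.
rewrite rinnerDl -/r; move: (rinner _ _) cs => c cs rc.
have eE : r ^+ 2 = 4 * (rnorm z ^+ 2 * e) + 4 * e.
  by rewrite /e; field; rewrite gt_eqF.
have ze := ler_wpM2l (sqr_ge0 (rnorm z)) (ltW ne).
have ye := ler_wpM2l (sqr_ge0 (rnorm z)) (ltW yu).
suff : e <= 0 by rewrite leNgt e0.
have := sqr_ge0 (r + 2 * c).
have : r ^+ 2 = 2 * (r + c) ^+ 2 + 2 * c ^+ 2 - (r + 2 * c) ^+ 2 by ring.
move: eE ze ye rc cs; rewrite [rnorm (y - u n) ^+ 2 * _]mulrC.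
move: (r ^+ 2) (_ * n.+1%:R^-1) (rnorm z ^+ 2 * e) ((r + c) ^+ 2) (c ^+ 2).
move: ((r + 2 * c) ^+ 2) (_ * rnorm (y - u n) ^+ 2) (e) => *; lra.
Unshelve. all: by end_near.
Qed.

End Existence.

(** * Selfadjoint operators, surjectivity of the square root, and the key estimate *)

Section Operators.
Context {R : realType} {k : scalars} {V : hilbertType R k}.
Local Notation K := (scalar_field R k).
Implicit Types (x y z : V) (A B X : set V) (T S H : operator V).

Lemma selfadjoint_sym T x y :
  selfadjoint T -> dom T x -> dom T y -> '[T x, y] = '[x, T y].
Proof.
move=> [_ _ TE] Tx Ty.
by have /(_ x Tx) : adjoint_graph T (y, T y) by rewrite -TE; split.
Qed.

Lemma linop0 T : linear_operator T -> T 0 = 0.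
Proof.
move=> [[T0 _] lT]; have := lT (-1) 0 0 T0 T0.
by rewrite scaler0 add0r scaleN1r addNr.
Qed.

Lemma linopZ T (a : K) x :
  linear_operator T -> dom T x -> T (a *: x) = a *: T x.
Proof.
move=> lT Tx; have := lT.2 a x 0 Tx (proj1 lT.1).
by rewrite addr0 linop0// addr0.
Qed.

Lemma linopD T x y :
  linear_operator T -> dom T x -> dom T y -> T (x + y) = T x + T y.
Proof. by move=> lT Tx Ty; have := lT.2 1 x y Tx Ty; rewrite !scale1r. Qed.

Lemma linopB T x y :
  linear_operator T -> dom T x -> dom T y -> T (x - y) = T x - T y.
Proof.
by move=> lT Tx Ty; rewrite addrC -scaleN1r lT.2// scaleN1r addrC.
Qed.

Lemma linop_sum T n (c : 'I_n -> K) (b : 'I_n -> V) : linear_operator T ->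
  (forall i, dom T (b i)) ->
  dom T (\sum_(i < n) c i *: b i) /\
  T (\sum_(i < n) c i *: b i) = \sum_(i < n) c i *: T (b i).
Proof.
move=> lT Tb; have sT := lT.1.
elim/big_ind2 : _ => [|x x' y y' [Tx <-] [Ty <-]|i _].
- by rewrite linop0//; case: sT.
- by rewrite linopD//; split=> //; apply: subspaceD.
- by rewrite linopZ//; split=> //; apply: subspaceZ.
Qed.

Lemma span_gen n (b : 'I_n -> V) i : span_of b (b i).
Proof.
exists (fun j => (j == i)%:R) => //.
rewrite (bigD1 i)//= eqxx scale1r big1 ?addr0// => j /negPf->.
by rewrite scale0r.
Qed.

Lemma finite_dim_image T X :
  linear_operator T -> X `<=` dom T -> finite_dim X -> finite_dim (T @` X).
Proof.
move=> lT XT [n [b XE]]; exists n, (T \o b).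
have Tb i : dom T (b i) by apply: XT; rewrite XE; apply: span_gen.
rewrite XE; apply/seteqP; split=> [_ [_ [c _ <-] <-]|_ [c _ <-]].
  by exists c => //; rewrite (linop_sum T n c b lT Tb).2.
by exists (\sum_i c i *: b i); [exists c|rewrite (linop_sum T n c b lT Tb).2].
Qed.

(** Chosen preimages of the generators of [X] span: by injectivity, a vector mapped to a combination
    of generators is the same combination of their preimages. *)
Lemma finite_dim_preim_op T X : linear_operator T ->
  (forall x, dom T x -> T x = 0 -> x = 0) -> X `<=` op_range T ->
  finite_dim X -> finite_dim (preim_op T X).
Proof.
move=> lT Tinj XT [n [b XE]]; subst X.
have /choice[b' b'P] i : exists y, dom T y /\ T y = b i.
  by have [y Ty <-] := XT _ (span_gen n b i); exists y.
have Tb' i : dom T (b' i) by case: (b'P i).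
have TbE c : T (\sum_i c i *: b' i) = \sum_i c i *: b i.
  rewrite (linop_sum T n c b' lT Tb').2.
  by apply: eq_bigr => i _; case: (b'P i) => _ ->.
have Tsum c := (linop_sum T n c b' lT Tb').1.
exists n, b'; apply/seteqP; split=> [x [Tx [c _ cE]]|_ [c _ <-]].
  exists c => //; apply/eqP; rewrite -subr_eq0; apply/eqP/Tinj.
    by apply: subspaceB => //; case: lT.
  by rewrite linopB// TbE cE subrr.
by split => //; rewrite TbE; exists c.
Qed.

Lemma subspace_preim_op T X :
  linear_operator T -> Defs.subspace X -> Defs.subspace (preim_op T X).
Proof.
move=> lT sX; split.
  by split; [case: lT.1|rewrite linop0//; case: sX].
move=> a x y [Tx Xx] [Ty Xy]; split; first by case: lT.1 => _; apply.
by rewrite lT.2//; case: sX => _; apply.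
Qed.

(** The part of v orthogonal to the range lies in the kernel of the adjoint, which is T itself, so
    it vanishes. *)
Lemma op_range_full T : selfadjoint T -> closed (op_range T) ->
  (forall x, dom T x -> T x = 0 -> x = 0) -> forall v, op_range T v.
Proof.
move=> [lT _ TE] cT Tinj v.
have sT : Defs.subspace (op_range T).
  split; first by exists 0; [case: lT.1|rewrite linop0].
  move=> a _ _ [x Tx <-] [y Ty <-]; exists (a *: x + y); last exact: lT.2.
  by case: lT.1 => _; apply.
have [y [Ty vy]] := closed_is_proj _ v sT cT.
have : adjoint_graph T (v - y, 0).
  by move=> x Tx /=; rewrite innerC vy ?rmorph0 ?inner0r//; exists x.
rewrite -TE => -[/= Tw w0].
by have /eqP := Tinj _ Tw w0; rewrite subr_eq0 => /eqP->.
Qed.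

(** A positive infimum keeps 0 out of the essential spectrum, so T - 0 is Fredholm. *)
Lemma closed_range_lambda_e T : (0 < lambda_e T)%E -> closed (op_range T).
Proof.
move=> l0; have -> : op_range T = op_range (shift_op T 0).
  rewrite /op_range; congr (_ @` _); apply/funext => x /=.
  by rewrite rmorph0 scale0r subr0.
suff [] : fredholm (shift_op T 0) by [].
apply: contrapT => nF; move: l0; apply/negP; rewrite -leNgt.
by apply: ereal_inf_lbound; exists 0.
Qed.

(** Injectivity of S passes to H = S S; then H is onto, and its range is contained in that of S. *)
Lemma sqrt_range_full S H :
  is_sqrt S H -> selfadjoint H -> (0 < lambda_e H)%E ->
  (forall x, dom S x -> S x = 0 -> x = 0) -> forall v, op_range S v.
Proof.
move=> [_ domH HE] saH lH Sinj v.
have [||x Hx <-] := @op_range_full H saH _ _ v.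
- exact: closed_range_lambda_e.
- move=> x Hx; rewrite HE//; move: Hx; rewrite domH => -[Sx SSx] /(Sinj _ SSx).
  exact: Sinj.
by rewrite HE//; move: Hx; rewrite domH => -[? ?]; exists (S x).
Qed.

Lemma linear_operator_proj A : Defs.subspace A ->
  (forall x, exists y, is_proj A x y) ->
  linear_operator (Operator setT (proj A)).
Proof.
move=> sA projA; split=> // a x y _ _ /=; apply: projE => //.
have [Ax xP] := projP _ _ (projA x); have [Ay yP] := projP _ _ (projA y).
split=> [|z Az]; first by case: sA => _; apply.
by rewrite opprD addrACA -scalerBr innerDl innerZl xP// yP// mulr0 addr0.
Qed.

(** The key estimate. It is one-sided; the other sign follows by replacing p with -p. *)
Lemma rinner_le_sin S H X p q : nonneg_selfadjoint H -> is_sqrt S H ->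
  (0 < lambda_e H)%E -> finite_dim X -> X `<=` dom S ->
  X p -> dom S q -> (forall z, X z -> '[q, z] = 0) ->
  let s := sin (max_principal_angle (S @` X) (preim_op S X)) in
  s < 1 -> rinner (S p) (S q) <= s * rnorm (S p) * rnorm (S q).
Proof.
move=> [saH _] sqS lH fX XS Xp Sq qX s.
have [[saS _] _ _] := sqS; have lS : linear_operator S by case: saS.
have sX := subspace_finite_dim _ fX.
have fA := finite_dim_image _ _ lS XS fX.
rewrite {}/s sin_max_principal_angle.
set A := S @` X in fA *; set B := preim_op S X.
have sA := subspace_finite_dim _ fA.
have projA := finite_dim_is_proj _ fA.
have sB : Defs.subspace B by apply: subspace_preim_op.
have Ap : A (S p) by exists p.
have SqB z : B z -> '[S q, z] = 0.
  by move=> [Sz Xz]; rewrite selfadjoint_sym// qX.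
case: (leP (gap A B) (gap B A)) => [_ _|AB s1].
  exact: rinner_le_gap.
set s := gap B A in AB s1 *; have s0 : 0 <= s := gap_ge0 _ _.
(* Here y is the part of b orthogonal to A, so |y|^2 = Re (b, y). The projection of y onto [B] is
   assumed to exist, as [B] is not yet known to be finite dimensional. *)
have gapB b y : B b -> is_proj A b (b - y) -> (exists y', is_proj B y y') ->
    rnorm y <= s * rnorm b.
  move=> Bb yP pB; have [y0|y0] := eqVneq (rnorm y) 0.
    by rewrite y0 mulr_ge0 ?rnorm_ge0.
  have ypos : 0 < rnorm y by rewrite lt_neqAle rnorm_ge0 eq_sym y0.
  have yA z : A z -> '[y, z] = 0.
    by move=> Az; have := yP.2 z Az; rewrite opprB addrC subrK.
  rewrite -(ler_pM2r ypos).
  apply: le_trans (rinner_le_gap _ _ _ _ sB sA Bb pB yA).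
  rewrite -expr2 -rinner_rnorm -subr_ge0 -rinnerBl rinnerC rinner_orth ?yA//.
  by case: yP.
(* With y = b the previous bound reads |b| <= s |b|, and s < 1. *)
have inj b : B b -> (forall z, A z -> '[b, z] = 0) -> b = 0.
  move=> Bb bA; have : rnorm b <= s * rnorm b.
    apply: gapB => //; last by exists b; split=> // z _; rewrite subrr inner0l.
    by rewrite subrr; split=> [|z Az]; [case: sA|rewrite subr0 bA].
  rewrite -subr_le0 -{1}[rnorm b]mul1r -mulrBl pmulr_rle0 ?subr_gt0// => b0.
  by apply/rnorm0_eq0/eqP; rewrite eq_le b0 rnorm_ge0.
have Sinj x : dom S x -> S x = 0 -> x = 0.
  move=> Sx Sx0; apply: inj; first by split=> //; rewrite Sx0; case: sX.
  move=> _ [z Xz <-]; rewrite -selfadjoint_sym ?Sx0 ?inner0l//; exact: XS.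
have Sfull := sqrt_range_full _ _ sqS saH lH Sinj.
have fB : finite_dim B by apply: finite_dim_preim_op => // v _; apply: Sfull.
have projB := finite_dim_is_proj _ fB.
(* Project S p onto the finite dimensional space P_A B. The residue S x, with x in X, is orthogonal
   to P_A B; writing x = S y with y in B gives (x, x) = (S x, y) = (S x, P_A y) = 0. *)
have [b Bb ab] : (proj A @` B) (S p).
  have lP := linear_operator_proj _ sA projA.
  have fPB := finite_dim_image (Operator setT (proj A)) B lP (@subsetT _ _) fB.
  have [_ [[b Bb <-] /= aP]] := finite_dim_is_proj _ fPB (S p).
  exists b => //; apply/esym/eqP; rewrite -subr_eq0; apply/eqP.
  have [Ab bP] := projP _ _ (projA b).
  have [x Xx xE] : A (S p - proj A b) by apply: subspaceB.
  have [y Sy yE] := Sfull x.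
  have By : B y by split; rewrite ?yE.
  suff : '[x, x] = 0.
    rewrite -inner_norm => /eqP; rewrite sqrf_eq0 normr_eq0 => /eqP x0.
    by rewrite -xE x0 linop0.
  rewrite -{2}yE -selfadjoint_sym//; last exact: XS.
  rewrite xE -[y](subrK (proj A y)) innerC innerDl.
  have [Ay yP] := projP _ _ (projA y).
  rewrite yP; last exact: subspaceB.
  by rewrite add0r innerC aP ?rmorph0//; exists y.
have bP := projP _ _ (projA b); rewrite ab in bP.
have yle : rnorm (b - S p) <= s * rnorm b.
  by apply: gapB => //; rewrite opprB addrC subrK.
have bE := is_proj_sqr _ _ _ bP.
have abE : rinner (S p) b = rnorm (S p) ^+ 2.
  rewrite rinnerC -rinner_rnorm; apply/eqP; rewrite -subr_eq0 -rinnerBl.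
  by rewrite rinner_orth// bP.2.
move: yle; rewrite -ler_sqr ?nnegrE ?mulr_ge0 ?rnorm_ge0// exprMn => yle.
(* As Re (S p, b) = |S p|^2, t b is the projection of S p onto the real line through b. Subtracting
   it leaves Re (S p, S q) unchanged, since S q is orthogonal to b. *)
pose t := rnorm (S p) ^+ 2 / rnorm b ^+ 2.
have -> : rinner (S p) (S q) = rinner (S p - of_real k t *: b) (S q).
  rewrite rinnerBl rinnerZl [rinner b _]rinnerC.
  by rewrite (rinner_orth _ _ (SqB _ Bb)) mulr0 subr0.
apply: le_trans (rinner_le _ _) _; rewrite ler_wpM2r ?rnorm_ge0//.
rewrite -ler_sqr ?nnegrE ?mulr_ge0 ?rnorm_ge0// exprMn.
rewrite rnormB_sqr rinnerZr abE rnormZ exprMn real_normK ?num_real//.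
have [b0|b0] := eqVneq (rnorm b ^+ 2) 0.
  have a0 : rnorm (S p) ^+ 2 = 0.
    by move: (sqr_ge0 (rnorm (S p))) (sqr_ge0 (rnorm (b - S p))); lra.
  by rewrite a0 b0 !mulr0 subr0 addr0.
have bpos : 0 < rnorm b ^+ 2 by rewrite lt_neqAle sqr_ge0 eq_sym b0.
rewrite -(ler_pM2r bpos).
(* The last factor is |b - S p|^2 by Pythagoras, hence at most s^2 |b|^2. *)
have -> : (rnorm (S p) ^+ 2 - 2 * (t * rnorm (S p) ^+ 2) +
    t ^+ 2 * rnorm b ^+ 2) * rnorm b ^+ 2 =
    rnorm (S p) ^+ 2 * (rnorm b ^+ 2 - rnorm (S p) ^+ 2).
  by rewrite /t; field; rewrite -sqrf_eq0.
rewrite [leRHS]mulrAC [leRHS]mulrC ler_wpM2l ?sqr_ge0//.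
by rewrite {1}bE addrAC subrr add0r.
Qed.

End Operators.

(** * From the key estimate to the form inequalities *)

Theorem theorem4p11 (R : realType) (k : scalars) (V : hilbertType R k)
    (h : sform V) (H S : operator V) (P : V -> V)
    (h_def : nonneg_definite h H)
    (H_assoc : associated h H S)
    (P_proj : orthogonal_projection P)
    (P_fin : finite_dim (range P))
    (P_dom : range P `<=` form_dom h) :
  let h' := block_diagonal h P in
  let s := sin (max_principal_angle (S @` range P) (preim_op S (range P))) in
  s < 1 ->
  forall u : V, form_dom h u ->
    (of_real k (1 - s) * h' u u <= h u u <= of_real k (1 + s) * h' u u) /\
    (of_real k (1 - s / (1 - s)) * h u u <= h' u u
       <= of_real k (1 + s / (1 - s)) * h u u).
Proof.
move=> h' s s1 u hu.
have [nsH sqS dS hS] := H_assoc; have [_ lH] := h_def.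
have [_ PP Psym] := P_proj.
have [[[lS _ _] _] _ _] := sqS.
have s0 : 0 <= s by rewrite /s sin_max_principal_angle le_min !gap_ge0.
have sX := subspace_finite_dim _ P_fin.
have XS : range P `<=` dom S by rewrite dS.
have Xp : range P (P u) by exists u.
have hp := P_dom _ Xp.
have hq : form_dom h (u - P u).
  by rewrite -dS in hu hp *; apply: subspaceB => //; case: lS.
have qX z : range P z -> '[u - P u, z] = 0.
  by move=> [x _ <-]; rewrite innerBl Psym PP subrr.
set p := S (P u); set q := S (u - P u).
have SuE : S u = p + q by rewrite -linopD ?dS// addrC subrK.
have pq : rinner p q <= s * rnorm p * rnorm q.
  by apply: rinner_le_sin nsH sqS lH P_fin XS _ _ qX s1 => //; rewrite dS.
(* The key estimate again, for the vector - P u of the same range. *)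
have npq : - rinner p q <= s * rnorm p * rnorm q.
  have SNp : S (- P u) = - p by rewrite -scaleN1r linopZ ?dS// scaleN1r.
  rewrite -rinnerNl -(rnormN p) -SNp.
  apply: rinner_le_sin nsH sqS lH P_fin XS _ _ qX s1; last by rewrite dS.
  by rewrite -scaleN1r; apply: subspaceZ.
have h'E : h' u u = of_real k (rnorm p ^+ 2 + rnorm q ^+ 2).
  by rewrite /h' /= !hS// !inner_rnorm -rmorphD.
have hE : h u u = of_real k (rnorm p ^+ 2 + rnorm q ^+ 2 + 2 * rinner p q).
  rewrite hS// inner_rnorm; congr (of_real k _).
  by rewrite SuE -!rinner_rnorm rinnerDl !rinnerDr (rinnerC q p); ring.
rewrite h'E hE -!rmorphM !ler_of_real.
have s'0 : 0 < 1 - s by rewrite subr_gt0.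
have amgm : s * (2 * (rnorm p * rnorm q)) <= s * (rnorm p ^+ 2 + rnorm q ^+ 2).
  by rewrite ler_wpM2l//; have := sqr_ge0 (rnorm p - rnorm q); lra.
(* Now h'[u] = a and h[u] = a + c, and all four inequalities reduce to |c| <= s a. *)
set a := rnorm p ^+ 2 + _ in amgm *; set c := 2 * rinner p q.
have ca : c <= s * a by rewrite /c; lra.
have nca : - c <= s * a by rewrite /c; lra.
have -> : 1 - s / (1 - s) = (1 - 2 * s) / (1 - s) by field; rewrite gt_eqF.
have -> : 1 + s / (1 - s) = 1 / (1 - s) by field; rewrite gt_eqF.
rewrite mulrAC ler_pdivrMr// mulrAC ler_pdivlMr// mul1r.
(* The lower bound for h'[u], cleared of 1 - s, is (1 - 2 s) c <= s a, which is the sum of these two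
   products. *)
have sac : 0 <= s * (s * a + c) by rewrite mulr_ge0//; lra.
have s'ac : 0 <= (1 - s) * (s * a - c) by apply: mulr_ge0 (ltW s'0) _; lra.
split; apply/andP; split; lra.
Qed.
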